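(* Let $(X,f,x_0)$ be a minimal counting system, let $\#$ be the unique iterator for $(X,f,x_0)$, and let $\oplus$ be the addition on $X$. There exists a unique binary operation $\otimes$ on $X$ such that \[ \#(A) \otimes \#(B) = \#(A \times B) \] for all finite sets $A$ and $B$. This operation $\otimes$ is both associative and commutative, $x \otimes x_0 = x_0$ and $x \otimes f(x_0) = x$ for all $x \in X$ (and so $f(x_0)$ is a multiplicative unit), and the distributive law holds for $\oplus$ and $\otimes$: for all $x, x_1, x_2 \in X$ \[ x \otimes (x_1 \oplus x_2) = (x \otimes x_1) \oplus (x \otimes x_2). \] Moreover, $\otimes$ is the unique binary operation on $X$ such that (m0) $x \otimes x_0 = x_0$ for all $x \in X$; (m1) $x \otimes f(x') = x \oplus (x \otimes x')$ for all $x, x' \in X$.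
   Context: For a set $A$ let $\mathcal{P}(A)$ denote its power set. A subset $\mathcal{K} \subset \mathcal{P}(A)$ is an inductive system in $\mathcal{P}(A)$ if $\varnothing \in \mathcal{K}$ and $B \cup \{a\} \in \mathcal{K}$ for all $B \in \mathcal{K}$ and $a \in A \setminus B$. A set $A$ is finite if $\mathcal{P}(A)$ itself is the only inductive system in $\mathcal{P}(A)$. Sets are those of ordinary set theory; in particular for every set $A$ there is an element not in $A$. A counting system is a triple $(X,f,x_0)$ with $X$ a set, $f : X \to X$ a mapping and $x_0 \in X$. A subset $Y \subset X$ is $f$-invariant if $f(Y) \subset Y$. The counting system is minimal if the only $f$-invariant subset of $X$ containing $x_0$ is $X$ itself. An iterator for $(X,f,x_0)$ is an assignment $A \mapsto \#(A)$ of an element of $X$ to each finite set $A$ such that $\#(\varnothing) = x_0$ and $\#(A \cup \{a\}) = f(\#(A))$ whenever $A$ is a finite set and $a \notin A$. Each counting system has a unique iterator. For a minimal counting system, the addition $\oplus$ is the unique binary operation on $X$ such that $\#(A) \oplus \#(B) = \#(A \cup B)$ whenever $A$ and $B$ are disjoint finite sets; equivalently, the unique binary operation with $x \oplus x_0 = x$ and $x \oplus f(x') = f(x \oplus x')$ for all $x,x' \in X$. *)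

(* Defs.v *)
From mathcomp Require Import all_boot.
From mathcomp Require Import boolp classical_sets.

Set Implicit Arguments.
Unset Strict Implicit.
Unset Printing Implicit Defensive.

Local Open Scope classical_set_scope.

(* Sets are the subsets [A : set U] of arbitrary types [U : Type]. Everything
   quantified over finite sets is therefore also quantified over [U], so that
   infinite ambient types are available (a new element can always be adjoined
   to a finite set), and the product of [A : set U] and [B : set V] is the
   subset [A `*` B] of [U * V]. *)

Definition power_set (U : Type) (A : set U) : set (set U) :=
  [set B | B `<=` A].

Definition inductive_system (U : Type) (A : set U) (K : set (set U)) : Prop :=
  [/\ K `<=` power_set A,
      K set0
    & forall B a, K B -> (A `\` B) a -> K (B `|` [set a])].

Definition is_finite (U : Type) (A : set U) : Prop :=
  forall K : set (set U), inductive_system A K -> K = power_set A.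

Definition invariant (X : Type) (f : X -> X) (Y : set X) : Prop :=
  f @` Y `<=` Y.

Definition minimal (X : Type) (f : X -> X) (x0 : X) : Prop :=
  forall Y : set X, invariant f Y -> Y x0 -> Y = setT.

(* An assignment of an element of X to each finite set is represented by a
   total function on sets; its values on infinite sets are arbitrary and are
   never constrained or used. *)
Definition is_iterator (X : Type) (f : X -> X) (x0 : X)
    (num : forall U : Type, set U -> X) : Prop :=
  (forall U : Type, num U set0 = x0) /\
  (forall (U : Type) (A : set U) (a : U), is_finite A -> ~ A a ->
     num U (A `|` [set a]) = f (num U A)).

Definition is_addition (X : Type) (num : forall U : Type, set U -> X)
    (add : X -> X -> X) : Prop :=
  forall (U : Type) (A B : set U), is_finite A -> is_finite B ->
    A `&` B = set0 -> add (num U A) (num U B) = num U (A `|` B).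

Definition is_multiplication (X : Type) (num : forall U : Type, set U -> X)
    (mul : X -> X -> X) : Prop :=
  forall (U V : Type) (A : set U) (B : set V), is_finite A -> is_finite B ->
    mul (num U A) (num V B) = num (U * V)%type (A `*` B).

(* Main.v *)
(** Minimality makes [e n := iter n f x0] surjective onto [X], and
    [e m (+) e n = e (m + n)]. Hence [e (m * n)] is the [n]-fold iterate of
    [(+) (e m)] and also the [m]-fold iterate of [(+) (e n)], so it depends only
    on the values [e m] and [e n]: the product of natural numbers descends
    along [e], together with its algebraic laws, even when [e] is not
    injective. *)
Require Import Defs.
From mathcomp Require Import all_boot.
From mathcomp Require Import boolp classical_sets.

Set Implicit Arguments.
Unset Strict Implicit.
Unset Printing Implicit Defensive.

Local Open Scope classical_set_scope.

(** * Closure of finiteness under adjunction and union, and induction on finite sets *)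

Section FiniteSets.
Variable U : Type.
Implicit Types (A B C : set U).

Lemma is_finite0 : is_finite (@set0 U).
Proof.
move=> K [Kpow K0 _]; apply/seteqP; split=> // B /= B0.
by have -> : B = set0 by apply/seteqP; split=> // x /B0.
Qed.

(** Given an inductive system [K] in the enlarged set, the [B] in [A] for which [K] contains both
    [B] and its extension by [a] form an inductive system in [A], hence are all subsets of [A].
    Every subset of the enlarged set has one of these two shapes. *)
Lemma is_finiteU1_notin A a : is_finite A -> ~ A a -> is_finite (A `|` [set a]).
Proof.
move=> Afin nAa K [Kpow K0 KS].
have /Afin K'E : inductive_system A
    [set B | [/\ B `<=` A, K B & K (B `|` [set a])]].
  split=> [B []//||B b [BA KB KBa] [Ab nBb]] /=.
    split=> //; apply: KS => //; split; first by right.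
    by case.
  split=> [x [/BA//|->//]||].
    by apply: KS => //; split=> //; left.
  rewrite setUAC; apply: KS => //; split; first by left.
  by case=> // ba; apply: nAa; rewrite -ba.
have KA B : B `<=` A -> K B /\ K (B `|` [set a]).
  by move=> BA; have : power_set A B by []; rewrite -K'E => -[].
apply/seteqP; split=> // B /= BAa.
have [Ba|nBa] := pselect (B a); last first.
  by have [] // := KA B => x Bx; case: (BAa x Bx) => // xa; case: nBa; rewrite -xa.
have -> : B = (B `\` [set a]) `|` [set a].
  apply/seteqP; split=> [x Bx|x [[]//|->//]].
  by have [->|xa] := pselect (x = a); [right | left].
have [] // := KA (B `\` [set a]) => x [Bx xa].
by case: (BAa x Bx).
Qed.

(** Finiteness of [B] is carried in the inductive system along with [P B], which makes it available
    in the induction step. *)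
Lemma is_finite_ind A (P : set U -> Prop) : is_finite A -> P set0 ->
  (forall B a, is_finite B -> ~ B a -> P B -> P (B `|` [set a])) -> P A.
Proof.
move=> Afin P0 PS.
have /Afin KE : inductive_system A [set B | [/\ B `<=` A, is_finite B & P B]].
  split=> [B []//||B b [BA Bfin PB] [Ab nBb]] /=.
    by split=> //; exact: is_finite0.
  split=> [x [/BA//|->//]||]; [exact: is_finiteU1_notin | exact: PS].
by have : power_set A A by []; rewrite -KE => -[].
Qed.

Lemma is_finiteU1 A a : is_finite A -> is_finite (A `|` [set a]).
Proof.
move=> Afin; have [Aa|] := pselect (A a); last exact: is_finiteU1_notin.
by have -> : A `|` [set a] = A by apply/seteqP; split=> [x [//|->//]|x]; left.
Qed.

Lemma is_finiteU A B : is_finite A -> is_finite B -> is_finite (A `|` B).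
Proof.
move=> Afin Bfin.
apply: (@is_finite_ind B (fun B => is_finite (A `|` B))) => //.
  by rewrite setU0.
by move=> C c _ _; rewrite setUA; exact: is_finiteU1.
Qed.

End FiniteSets.

(** * Finiteness of products *)

Section Products.
Variables U V : Type.
Implicit Types (A : set U) (B C : set V).

Lemma setXUr A B C : A `*` (B `|` C) = (A `*` B) `|` (A `*` C).
Proof.
apply/seteqP; split=> [[x y] /= [Ax [By|Cy]]|[x y] /= [[Ax By]|[Ax Cy]]].
- by left.
- by right.
- by split=> //; left.
- by split=> //; right.
Qed.

Lemma setXU1l A a (b : V) :
  (A `|` [set a]) `*` [set b] = (A `*` [set b]) `|` [set (a, b)].
Proof.
apply/seteqP; split=> [[x y] /= [[Ax|->] ->]|[x y] /= [[Ax ->]|[-> ->]]].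
- by left.
- by right.
- by split=> //; left.
- by split=> //; right.
Qed.

Lemma is_finiteX1 A (b : V) : is_finite A -> is_finite (A `*` [set b]).
Proof.
move=> Afin; apply: (@is_finite_ind _ A (fun A => is_finite (A `*` [set b]))) => //.
  by rewrite set0X; exact: is_finite0.
by move=> C c _ _; rewrite setXU1l; exact: is_finiteU1.
Qed.

Lemma is_finiteX A B : is_finite A -> is_finite B -> is_finite (A `*` B).
Proof.
move=> Afin Bfin.
apply: (@is_finite_ind _ B (fun B => is_finite (A `*` B))) => //.
  by rewrite setX0; exact: is_finite0.
by move=> C c _ _ ACfin; rewrite setXUr; apply: is_finiteU => //; exact: is_finiteX1.
Qed.

End Products.

(** * Intervals of natural numbers as model finite sets *)

Definition nat_interval (a n : nat) : set nat := [set k | (a <= k < a + n)%N].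

Lemma nat_interval0 a : nat_interval a 0 = set0.
Proof. by apply/seteqP; split=> // k; rewrite /nat_interval /= addn0 ltnNge andbN. Qed.

Lemma nat_intervalS a n :
  nat_interval a n.+1 = nat_interval a n `|` [set (a + n)%N].
Proof.
apply/seteqP; split=> k; rewrite /nat_interval /= addnS ltnS.
  by case/andP=> ak; rewrite leq_eqVlt => /orP[/eqP ->|kn]; [right|left; rewrite ak].
by move=> [/andP[-> /ltnW]//|->]; rewrite leq_addr leqnn.
Qed.

Lemma nat_interval_max a n : ~ nat_interval a n (a + n)%N.
Proof. by rewrite /nat_interval /= ltnn andbF. Qed.

Lemma is_finite_nat_interval a n : is_finite (nat_interval a n).
Proof.
elim: n => [|n IHn]; first by rewrite nat_interval0; exact: is_finite0.
by rewrite nat_intervalS; exact: is_finiteU1.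
Qed.

Lemma nat_intervalD m n :
  nat_interval 0 m `|` nat_interval m n = nat_interval 0 (m + n).
Proof.
elim: n => [|n IHn]; first by rewrite nat_interval0 setU0 addn0.
by rewrite nat_intervalS setUA IHn addnS nat_intervalS.
Qed.

Lemma nat_intervalI m n : nat_interval 0 m `&` nat_interval m n = set0.
Proof.
apply/seteqP; split=> // k [] /=; rewrite /nat_interval /= add0n => km /andP[mk _].
by move: km; rewrite ltnNge mk.
Qed.

(** * Arithmetic transported along the orbit of [x0] *)

Section CountingSystem.
Variables (X : Type) (f : X -> X) (x0 : X).
Variables (num : forall U : Type, set U -> X) (oplus : X -> X -> X).
Hypothesis Hmin : minimal f x0.
Hypothesis Hnum : is_iterator f x0 num.
Hypothesis Hadd : is_addition num oplus.

#[local] Arguments num {U} _.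

Let e n := iter n f x0.

(** The orbit of [x0] is invariant and contains [x0], so minimality makes it all of [X]. *)
Lemma iter_surj x : exists n, x = e n.
Proof.
have /seteqP[_] : [set x | exists n, x = e n] = setT; last exact.
apply: Hmin; last by exists 0%N.
by move=> _ [_ [n ->] <-]; exists n.+1.
Qed.

Lemma num_nat_interval a n : num (nat_interval a n) = e n.
Proof.
have [num0 numS] := Hnum.
elim: n => [|n IHn]; first by rewrite nat_interval0 num0.
rewrite nat_intervalS numS ?IHn//; last exact: nat_interval_max.
exact: is_finite_nat_interval.
Qed.

(** The free left end of [nat_interval] serves here: adjacent intervals are disjoint sets in one
    type, so [Hadd] applies to them. *)
Lemma oplus_iter m n : oplus (e m) (e n) = e (m + n).
Proof.
rewrite -(num_nat_interval 0 m) -(num_nat_interval m n) Hadd.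
- by rewrite nat_intervalD num_nat_interval.
- exact: is_finite_nat_interval.
- exact: is_finite_nat_interval.
- exact: nat_intervalI.
Qed.

Lemma iter_oplus m n : iter n (oplus (e m)) x0 = e (m * n).
Proof.
by elim: n => [|n IHn]; rewrite ?muln0//= IHn oplus_iter mulnS.
Qed.

(** After commuting the factors, [n] enters only through the map [oplus (e n)] that is iterated [m]
    times. *)
Lemma iter_mul_congr m n n' : e n = e n' -> e (m * n) = e (m * n').
Proof. by move=> en; rewrite ![(m * _)%N]mulnC -!iter_oplus en. Qed.

Lemma iter_mulP :
  exists otimes, forall m n, otimes (e m) (e n) = e (m * n).
Proof.
pose g x := projT1 (cid (iter_surj x)).
have gK x : e (g x) = x by rewrite /g; case: cid.
exists (fun x y => e (g x * g y)) => m n.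
(* The congruence acts on the right factor only, so the chosen indices are replaced one at a time,
   with a swap in between. *)
rewrite (@iter_mul_congr _ _ n) ?gK// mulnC.
by rewrite (@iter_mul_congr _ _ m) ?gK// mulnC.
Qed.

Lemma numX1 (U V : Type) (A : set U) (b : V) :
  is_finite A -> num (A `*` [set b]) = num A.
Proof.
have [num0 numS] := Hnum => Afin.
apply: (@is_finite_ind _ A (fun A => num (A `*` [set b]) = num A)) => //.
  by rewrite set0X !num0.
move=> C c Cfin nCc IH; rewrite setXU1l !numS ?IH//; first exact: is_finiteX1.
by case.
Qed.

(** The new slice over [b] is disjoint from the rest of the product and has the same number as
    [A]. *)
Lemma numX_setU1 (U V : Type) (A : set U) (B : set V) (b : V) :
  is_finite A -> is_finite B -> ~ B b ->
  num (A `*` (B `|` [set b])) = oplus (num (A `*` B)) (num A).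
Proof.
move=> Afin Bfin nBb; rewrite setXUr -Hadd ?numX1//.
- exact: is_finiteX.
- exact: is_finiteX1.
- by apply/seteqP; split=> // -[x y] [/= [_ By] [_ yb]]; apply: nBb; rewrite -yb.
Qed.

(** Turns the condition on finite sets into arithmetic of indices, where uniqueness and the
    algebraic laws are immediate. *)
Lemma is_multiplication_iter (otimes : X -> X -> X) :
  is_multiplication (@num) otimes <->
  (forall m n, otimes (e m) (e n) = e (m * n)).
Proof.
have [num0 numS] := Hnum.
suff numX (o : X -> X -> X) : (forall m n, o (e m) (e n) = e (m * n)) ->
    is_multiplication (@num) o.
  split=> [Ho m n|]; last exact: numX.
  (* The number of a product of two intervals is found without counting it: [o'] satisfies the index
     formula, so by [numX] it already computes that number. *)
  have [o' o'E] := iter_mulP.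
  rewrite -o'E -(num_nat_interval 0 m) -(num_nat_interval 0 n).
  by rewrite Ho ?(numX o')//; exact: is_finite_nat_interval.
move=> oE U V A B Afin Bfin.
apply: (@is_finite_ind _ B (fun B => o (num A) (num B) = num (A `*` B))) => //.
  (* [x0] is [e 0] by conversion, which is why [oE] is given the index [0] explicitly; likewise
     [f (e n)] is [e n.+1] below. *)
  by rewrite setX0 !num0; have [m ->] := iter_surj (num A);
     rewrite (oE m 0%N) muln0.
move=> C c Cfin nCc IH; rewrite numX_setU1// -IH numS//.
have [m ->] := iter_surj (num A); have [n ->] := iter_surj (num C).
by rewrite (oE m n.+1) oE oplus_iter mulnSr.
Qed.

(** The recursion equations say that [otimes (e m) (e n)] is the [n]-fold iterate of [oplus (e m)]
    at [x0], which [iter_oplus] evaluates. *)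
Lemma recursive_mul_iter (otimes : X -> X -> X) :
  (forall x, otimes x x0 = x0) /\
  (forall x x', otimes x (f x') = oplus x (otimes x x')) <->
  (forall m n, otimes (e m) (e n) = e (m * n)).
Proof.
split=> [[o0 oS] m n|oE].
  rewrite -iter_oplus.
  by elim: n => [|n IHn]; rewrite ?o0//= oS IHn.
split=> [x|x x']; have [m ->] := iter_surj x.
  by rewrite (oE m 0%N) muln0.
have [n ->] := iter_surj x'.
by rewrite (oE m n.+1) oE oplus_iter mulnS.
Qed.

End CountingSystem.

(** * Existence, uniqueness and laws of the multiplication *)

Theorem theorem5p2 (X : Type) (f : X -> X) (x0 : X)
    (num : forall U : Type, set U -> X) (oplus : X -> X -> X)
    (Hmin : minimal f x0)
    (Hnum : is_iterator f x0 num)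
    (Hadd : is_addition num oplus) :
  exists otimes : X -> X -> X,
    unique (is_multiplication num) otimes /\
    associative otimes /\
    commutative otimes /\
    (forall x : X, otimes x x0 = x0) /\
    (forall x : X, otimes x (f x0) = x) /\
    (forall x : X, otimes (f x0) x = x) /\
    (forall x x1 x2 : X,
       otimes x (oplus x1 x2) = oplus (otimes x x1) (otimes x x2)) /\
    unique (fun m : X -> X -> X =>
              (forall x : X, m x x0 = x0) /\
              (forall x x' : X, m x (f x') = oplus x (m x x'))) otimes.
Proof.
have surj := iter_surj Hmin.
have [o oE] := iter_mulP Hmin Hnum Hadd.
(* Both uniqueness claims reduce to this one, since each characterization is equivalent to the same
   index formula. *)
have o_uniq o' : (forall m n, o' (iter m f x0) (iter n f x0) = iter (m * n) f x0) ->
    o = o'.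
  move=> o'E; apply/funext => x; apply/funext => y.
  by have [[m ->] [n ->]] := (surj x, surj y); rewrite oE o'E.
exists o; split; last split; last split; last split; last split; last split;
  last split.
- split; first exact/(is_multiplication_iter Hmin Hnum Hadd).
  by move=> o' /(is_multiplication_iter Hmin Hnum Hadd); exact: o_uniq.
- move=> x y z; have [[m ->] [n ->] [p ->]] := And3 (surj x) (surj y) (surj z).
  by rewrite !oE mulnA.
- by move=> x y; have [[m ->] [n ->]] := (surj x, surj y); rewrite !oE mulnC.
- by move=> x; have [m ->] := surj x; rewrite (oE m 0%N) muln0.
- by move=> x; have [m ->] := surj x; rewrite (oE m 1%N) muln1.
- by move=> x; have [m ->] := surj x; rewrite (oE 1%N m) mul1n.
- move=> x y z; have [[m ->] [n ->] [p ->]] := And3 (surj x) (surj y) (surj z).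
  by rewrite !(oplus_iter Hnum Hadd, oE) mulnDr.
- split; first exact/(recursive_mul_iter Hmin Hnum Hadd).
  by move=> o' /(recursive_mul_iter Hmin Hnum Hadd); exact: o_uniq.
Qed.
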